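(* Let $\mathcal{G}_1$ be a set of continuously differentiable functions $g:\mathbb{R}^d\to\mathbb{R}$ such that for all $g\in\mathcal{G}_1$ one has $\nabla g(\mathbf{X})\neq 0$ almost surely. Then for all $g\in\mathcal{G}_1$ we have $\mathcal{J}(g)=0$ if and only if $\mathcal{L}_1(g)=0$.
   Context: $\mathbf{X}$ is a random vector in $\mathbb{R}^d$ with law $\mu$, and $u:\mathbb{R}^d\to\mathbb{R}$ is a continuously differentiable function. For a vector $\mathbf{v}\in\mathbb{R}^d$, $\Pi^{\perp}_{\mathbf{v}}$ denotes the orthogonal projector of $\mathbb{R}^d$ onto the orthogonal complement of $\mathrm{span}\{\mathbf{v}\}$ (so $\Pi^\perp_{0}=I_d$). For $g\in C^1(\mathbb{R}^d,\mathbb{R})$, $$\mathcal{J}(g):=\mathbb{E}\big[\|\Pi^{\perp}_{\nabla g(\mathbf{X})}\nabla u(\mathbf{X})\|_2^2\big],\qquad \mathcal{L}_1(g):=\mathbb{E}\big[\|\nabla u(\mathbf{X})\|_2^2\,\|\Pi^{\perp}_{\nabla u(\mathbf{X})}\nabla g(\mathbf{X})\|_2^2\big].$$ *)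

(* Defs.v *)
From HB Require Import structures.
From mathcomp Require Import all_boot all_order all_algebra.
From mathcomp Require Import all_classical all_reals all_analysis.

Set Implicit Arguments.
Unset Strict Implicit.
Unset Printing Implicit Defensive.

Import Order.TTheory GRing.Theory Num.Theory.
Import numFieldNormedType.Exports.

Local Open Scope classical_set_scope.
Local Open Scope ring_scope.

(* Vectors of R^d are row vectors. The library equips 'rV[R]_d with its
   topology but with no sigma-algebra: this is the Borel one. *)
Notation borel_rV R d := (g_sigma_algebraType (@open 'rV[R]_d)).

Definition enorm (R : realType) (d : nat) (v : 'rV[R]_d) : R :=
  Num.sqrt (\sum_(i < d) v 0 i ^+ 2).

Definition grad (R : realType) (d : nat) (g : 'rV[R]_d -> R) (x : 'rV[R]_d)
    : 'rV[R]_d :=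
  \row_(i < d) 'D_(delta_mx 0 i) g x.

Definition C1 (R : realType) (d : nat) (g : 'rV[R]_d -> R) : Prop :=
  (forall x : 'rV[R]_d, differentiable g x) /\ continuous (grad g).

(* Acts on row vectors by right multiplication. The row space of kermx v^T
   is the set of w with w *m v^T = 0, i.e. the orthogonal complement of
   span{v}; proj_mx A B projects onto A along B. *)
Definition perp_proj (R : realType) (d : nat) (v : 'rV[R]_d) : 'M[R]_d :=
  proj_mx (kermx v^T) <<v>>%MS.

Section losses.
Context {dT : measure_display} {T : measurableType dT} {R : realType}
  (P : probability T R) {d : nat} (X : {RV P >-> borel_rV R d})
  (u : 'rV[R]_d -> R).

(* Both are expectations of nonnegative functions, with values in [0, +oo]. *)
Definition lossJ (g : 'rV[R]_d -> R) : \bar R :=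
  'E_P[fun w => enorm (grad u (X w) *m perp_proj (grad g (X w))) ^+ 2].

Definition lossL1 (g : 'rV[R]_d -> R) : \bar R :=
  'E_P[fun w => enorm (grad u (X w)) ^+ 2 *
                enorm (grad g (X w) *m perp_proj (grad u (X w))) ^+ 2].

End losses.

(* Main.v *)
Require Import Defs.
From mathcomp Require Import all_boot all_order all_algebra.
From mathcomp Require Import all_classical all_reals all_analysis.
From mathcomp Require Import measurable_realfun ring.
Import Order.TTheory GRing.Theory Num.Theory.
Import numFieldNormedType.Exports.
Local Open Scope classical_set_scope.
Local Open Scope ring_scope.

(** Write [gram v w] for the Gram determinant |v|^2 |w|^2 - <v, w>^2 of two
    vectors; it is symmetric in v and w, and it equals |v|^2 times the squared
    norm of the projection of w onto the orthogonal complement of v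
    ([sqr_enorm_perp_proj], valid also when v = 0). Hence, pointwise, the
    integrand of L_1(g) is gram (grad u) (grad g), and it is also |grad g|^2
    times the integrand of J(g). Since grad g (X) is almost surely nonzero, the
    two integrands almost surely vanish together.

    Both integrands are nonnegative and measurable: by the closed form
    [enorm_perp_proj] of the projected norm they are built by differences,
    products and one inverse from inner products of the continuous gradients.
    Such a function has zero expectation if and only if it vanishes almost
    surely ([expectation_eq0]), and the equivalence follows. *)

(** The Euclidean inner product. *)
Definition dot (R : realType) (d : nat) (v w : 'rV[R]_d) : R :=
  \sum_(i < d) v 0 i * w 0 i.
Arguments dot {R d} v w.

(** The Gram determinant of two vectors, the squared area of the parallelogram
    that they span. *)
Definition gram (R : realType) (d : nat) (v w : 'rV[R]_d) : R :=
  dot v v * dot w w - dot v w ^+ 2.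
Arguments gram {R d} v w.

Lemma mulmx_tr_dot (R : realType) (d : nat) (v w : 'rV[R]_d) :
  v *m w^T = (dot v w)%:M.
Proof.
apply/matrixP => i j; rewrite !ord1 !mxE eqxx mulr1n.
by apply: eq_bigr => k _; rewrite mxE.
Qed.

Lemma dotC (R : realType) (d : nat) (v w : 'rV[R]_d) : dot v w = dot w v.
Proof. by apply: eq_bigr => i _; rewrite mulrC. Qed.

Lemma dotv0 (R : realType) (d : nat) (v : 'rV[R]_d) : dot v 0 = 0.
Proof. by apply: big1 => i _; rewrite mxE mulr0. Qed.

Lemma dotvv_ge0 (R : realType) (d : nat) (v : 'rV[R]_d) : 0 <= dot v v.
Proof. by apply: sumr_ge0 => i _; rewrite -expr2 sqr_ge0. Qed.

Lemma dotvv_eq0 (R : realType) (d : nat) (v : 'rV[R]_d) :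
  (dot v v == 0) = (v == 0).
Proof.
apply/eqP/eqP => [|->]; last exact: dotv0.
move/eqP; rewrite psumr_eq0 => [/allP v0|i _]; last by rewrite -expr2 sqr_ge0.
apply/rowP => i; have := v0 i (mem_index_enum i).
by rewrite /= mulf_eq0 orbb mxE => /eqP.
Qed.

Lemma enorm_sqr (R : realType) (d : nat) (v : 'rV[R]_d) :
  enorm v ^+ 2 = dot v v.
Proof.
rewrite /enorm sqr_sqrtr; last by apply: sumr_ge0 => i _; rewrite sqr_ge0.
by apply: eq_bigr => i _; rewrite expr2.
Qed.

Lemma gramC (R : realType) (d : nat) (v w : 'rV[R]_d) : gram v w = gram w v.
Proof. by rewrite /gram mulrC dotC. Qed.

(** The usual formula for the projector. For v = 0 it reads w = w, because the
    inverse of 0 is 0. *)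
Lemma mulmx_perp_proj (R : realType) (d : nat) (v w : 'rV[R]_d) :
  w *m perp_proj v = w - (dot w v / dot v v) *: v.
Proof.
have cap0 : (kermx v^T :&: <<v>>)%MS = 0.
  apply/eqP/rowV0P => x; rewrite sub_capmx genmxE => /andP[/sub_kermxP xv].
  move=> /sub_rVP[a xE]; move: xv; rewrite xE -scalemxAl mulmx_tr_dot.
  move=> /matrixP/(_ 0 0)/eqP; rewrite !mxE eqxx mulr1n mulf_eq0 dotvv_eq0.
  by case/orP => /eqP ->; rewrite ?scale0r ?scaler0.
rewrite /perp_proj -{1}(subrK ((dot w v / dot v v) *: v) w) mulmxDl.
rewrite proj_mx_id// ?proj_mx_0 ?addr0//.
  by rewrite genmxE scalemx_sub.
apply/sub_kermxP; rewrite mulmxBl -scalemxAl !mulmx_tr_dot.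
apply/matrixP => i j; rewrite !ord1 !mxE eqxx !mulr1n.
have [->|v0] := eqVneq v 0; first by rewrite !dotv0 mulr0 subr0.
by rewrite divfK ?subrr// dotvv_eq0.
Qed.

Lemma enorm_perp_proj (R : realType) (d : nat) (v w : 'rV[R]_d) :
  enorm (w *m perp_proj v) ^+ 2 = dot w w - dot w v ^+ 2 / dot v v.
Proof.
rewrite enorm_sqr mulmx_perp_proj; set c := _ / _.
have -> : dot (w - c *: v) (w - c *: v)
        = dot w w - 2 * c * dot w v + c ^+ 2 * dot v v.
  rewrite /dot !mulr_sumr -sumrB -big_split/=; apply: eq_bigr => i _.
  by rewrite !mxE; ring.
rewrite /c; have [->|v0] := eqVneq v 0; first by rewrite !dotv0; ring.
by field; rewrite dotvv_eq0.
Qed.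

Lemma sqr_enorm_perp_proj (R : realType) (d : nat) (v w : 'rV[R]_d) :
  enorm v ^+ 2 * enorm (w *m perp_proj v) ^+ 2 = gram v w.
Proof.
rewrite enorm_perp_proj enorm_sqr /gram (dotC _ _ v w).
have [->|v0] := eqVneq v 0; first by rewrite !dotv0; ring.
by field; rewrite dotvv_eq0.
Qed.

Lemma dot_continuous (R : realType) (d : nat) (f h : 'rV[R]_d -> 'rV[R]_d) :
  continuous f -> continuous h -> continuous (fun x => dot (f x) (h x)).
Proof.
move=> fc hc; apply: continuous_big => [|i _]; first exact: add_continuous.
have coord (k : 'rV[R]_d -> 'rV[R]_d) : continuous k ->
    continuous (fun x => k x 0 i).
  move=> kc x; apply: (@continuous_comp _ _ _ k (fun M : 'rV[R]_d => M 0 i)).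
    exact: kc.
  exact: coord_continuous.
by move=> x; apply: continuousM; exact: coord.
Qed.

Lemma continuous_measurable_borel_rV (R : realType) (d : nat)
    (f : 'rV[R]_d -> R) :
  continuous f -> measurable_fun [set: borel_rV R d] f.
Proof.
move=> /continuousP fc.
apply: (measurability _ (RGenOpens.measurableE R)).
move=> _ [_ [a [b ->] <-]]; rewrite setTI.
by apply: sub_sigma_algebra; apply: fc; exact: interval_open.
Qed.

(** On nonnegative reals the inverse is the power of exponent -1, at 0 too,
    where both are 0. *)
Lemma measurable_invr_ge0 (R : realType) (dT : measure_display)
    (T : measurableType dT) (f : T -> R) :
  measurable_fun setT f -> (forall x, 0 <= f x) ->
  measurable_fun setT (fun x => (f x)^-1).
Proof.
move=> mf f0; under eq_fun => x do rewrite -powR_inv1//.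
exact: (measurableT_comp (measurable_powR _)).
Qed.

Lemma expectation_eq0 (R : realType) (dT : measure_display)
    (T : measurableType dT) (P : probability T R) (f : T -> R) :
  measurable_fun setT f -> (forall w, 0 <= f w) ->
  ('E_P[f] = 0)%E <-> {ae P, forall w, f w = 0}.
Proof.
move=> mf f0; rewrite unlock.
have -> : (\int[P]_w (f w)%:E = \int[P]_w `|(f w)%:E|)%E.
  by apply: eq_integral => w _; rewrite gee0_abs// lee_fin.
rewrite (ae_eq_integral_abs P measurableT (f := EFin \o f)); last first.
  exact/measurable_EFinP.
by split; apply: filterS => w /=; [move=> /(_ I) []|move=> -> _].
Qed.

Theorem proposition4p4 (R : realType) (d : nat)
    (dT : measure_display) (T : measurableType dT) (P : probability T R)
    (X : {RV P >-> borel_rV R d})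
    (u : 'rV[R]_d -> R) (u_C1 : C1 u)
    (G1 : set ('rV[R]_d -> R))
    (G1_C1 : forall g, G1 g -> C1 g)
    (G1_grad : forall g, G1 g -> {ae P, forall w, grad g (X w) != 0}) :
  forall g, G1 g -> (lossJ X u g = 0%E <-> lossL1 X u g = 0%E).
Proof.
move=> g Gg.
have [_ gc] := G1_C1 g Gg; have [_ uc] := u_C1.
have mdot (f h : 'rV[R]_d -> 'rV[R]_d) : continuous f -> continuous h ->
    measurable_fun setT (fun w => dot (f (X w)) (h (X w))).
  move=> fc hc.
  have mfh := continuous_measurable_borel_rV _ _ _
    (dot_continuous _ _ _ _ fc hc).
  exact: measurableT_comp mfh (measurable_funPT X).
have muu := mdot _ _ uc uc; have mgg := mdot _ _ gc gc.
have mug := mdot _ _ uc gc.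
have vanish w : grad g (X w) != 0 ->
    enorm (grad u (X w) *m perp_proj (grad g (X w))) ^+ 2 = 0 <->
    enorm (grad u (X w)) ^+ 2 *
      enorm (grad g (X w) *m perp_proj (grad u (X w))) ^+ 2 = 0.
  move=> gw; rewrite sqr_enorm_perp_proj gramC -sqr_enorm_perp_proj.
  rewrite (enorm_sqr _ _ (grad g (X w))).
  split=> [->|/eqP]; first by rewrite mulr0.
  by rewrite mulf_eq0 dotvv_eq0 (negPf gw) => /eqP.
rewrite /lossJ /lossL1 !expectation_eq0.
- split=> z; apply: filterS2 (G1_grad g Gg) z => w /vanish vw.
  + by rewrite vw.
  + by rewrite -vw.
- under eq_fun => w do rewrite sqr_enorm_perp_proj.
  apply: measurable_funB; first exact: measurable_funM.
  exact: measurable_funX.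
- by move=> w; rewrite mulr_ge0// sqr_ge0.
- under eq_fun => w do rewrite enorm_perp_proj.
  apply: measurable_funB => //; apply: measurable_funM.
    exact: measurable_funX.
  by apply: measurable_invr_ge0 => // w; exact: dotvv_ge0.
- by move=> w; exact: sqr_ge0.
Qed.
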